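(* Let $\mathbb{K}$ be a field of characteristic $0$ and let $(d_n)_{n\in\mathbb{N}}$ be a sequence of positive integers with $d_n\le n^2$ for all $n$ and $\liminf_{n\to\infty}\frac{d_n}{n^2}>\frac{5}{16}$. Then for any sufficiently large $n$, a generic quadratic $\mathbb{K}$-algebra with $n$ generators and $d_n$ relations has Hilbert series being a polynomial of degree at most $5$ and therefore is finite dimensional.
   Context: A quadratic $\mathbb{K}$-algebra with $n$ generators and $d$ relations is $R=\mathbb{K}\langle x_1,\dots,x_n\rangle/I$, where all generators $x_i$ have degree $1$, and $I$ is the two-sided ideal generated by $d$ linearly independent homogeneous elements $f_j=\sum_{k,m=1}^n c_{j,k,m}x_kx_m$, $1\le j\le d$, $c_{j,k,m}\in\mathbb{K}$. It is graded, $R=\bigoplus_{q\ge 0}R_q$, and its Hilbert series is $H_R(t)=\sum_{q\ge0}(\dim_{\mathbb{K}}R_q)t^q$. ''A generic quadratic $\mathbb{K}$-algebra with $n$ generators and $d$ relations has property $\mathcal{P}$'' means: the set of coefficient vectors $(c_{j,k,m})\in\mathbb{K}^{n^2d}$ for which the corresponding algebra $R$ has property $\mathcal{P}$ contains a dense Zariski open subset of $\mathbb{K}^{n^2d}$. *)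

(* Defs.v *)
From HB Require Import structures.
From mathcomp Require Import all_boot all_order all_algebra.
From mathcomp Require Import all_classical all_reals all_analysis.
(* The notations of multinomials clash with those of mathcomp-analysis. *)
From mathcomp.multinomials Require Import -(notations) mpoly.
From mathcomp.multinomials Require Import -(notations) monalg.

Set Implicit Arguments.
Unset Strict Implicit.
Unset Printing Implicit Defensive.

Import Order.TTheory GRing.Theory Num.Theory.

Local Open Scope ring_scope.
Local Open Scope quotient_scope.
Local Open Scope classical_set_scope.

Section LinearAlgebra.
Variables (K : fieldType) (V : lmodType K).

Definition lin_indep (m : nat) (b : 'I_m -> V) : Prop :=
  forall a : 'I_m -> K, \sum_i a i *: b i = 0 -> forall i, a i = 0.

Definition lin_span (m : nat) (b : 'I_m -> V) : set V :=
  [set v | exists a : 'I_m -> K, v = \sum_i a i *: b i].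

(* [W] is a linear subspace of [V] of finite dimension [m]. *)
Definition has_dim (W : set V) (m : nat) : Prop :=
  exists2 b : 'I_m -> V, lin_indep b & W = lin_span b.

End LinearAlgebra.

Section TwoSidedIdeals.
Variable A : nzRingType.

Definition two_sided_ideal (J : set A) : Prop :=
  [/\ J 0,
      forall x y, J x -> J y -> J (x - y),
      forall a x, J x -> J (a * x) &
      forall a x, J x -> J (x * a)].

Definition ideal_gen (S : set A) : set A := smallest two_sided_ideal S.

Lemma two_sided_ideal_gen (S : set A) : two_sided_ideal (ideal_gen S).
Proof.
split=> [J [[J0 _ _ _] _]|x y Ix Iy J JS|a x Ix J JS|a x Ix J JS] //.
- by have [[_ JB _ _] _] := JS; apply: JB; [apply: Ix|apply: Iy].
- by have [[_ _ JM _] _] := JS; apply: JM; apply: Ix.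
- by have [[_ _ _ JM] _] := JS; apply: JM; apply: Ix.
Qed.

End TwoSidedIdeals.

(* The Zariski topology on the set K^N of K-points of affine N-space. *)
Definition zariski (K : fieldType) (N : nat) : Type := 'rV[K]_N.

Section Zariski.
Variables (K : fieldType) (N : nat).

HB.instance Definition _ := Choice.on (zariski K N).

Definition mpoly_at (p : mpoly.mpoly N K) (x : zariski K N) : K :=
  mpoly.meval (fun i => x 0 i) p.

Definition zariski_open (U : set (zariski K N)) : Prop :=
  exists S : set (mpoly.mpoly N K), U = [set x | exists2 p, S p & mpoly_at p x != 0].

Let openT : zariski_open setT.
Proof.
exists [set (1 : mpoly.mpoly N K)]; apply/seteqP; split=> x // _.
by exists 1 => //; rewrite /mpoly_at rmorph1 oner_neq0.
Qed.

Let openI (U V : set (zariski K N)) :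
  zariski_open U -> zariski_open V -> zariski_open (U `&` V).
Proof.
move=> [S ->] [T ->]; exists [set r | exists p q, [/\ S p, T q & r = p * q]].
apply/seteqP; split=> x /=.
  move=> [[p Sp px] [q Tq qx]]; exists (p * q); first by exists p, q.
  by rewrite /mpoly_at rmorphM mulf_neq0.
move=> [_ [p [q [Sp Tq ->]]]].
rewrite /mpoly_at rmorphM mulf_eq0 negb_or => /andP[px qx].
by split; [exists p | exists q].
Qed.

Let open_bigcup (I : Type) (f : I -> set (zariski K N)) :
  (forall i, zariski_open (f i)) -> zariski_open (\bigcup_i f i).
Proof.
move=> /choice[S fS]; exists (\bigcup_i S i).
apply/seteqP; split=> x /=.
  by move=> [i _]; rewrite fS => -[p Sp px]; exists p => //; exists i.
by move=> [p [i _ Sp] px]; exists i => //; rewrite fS; exists p.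
Qed.

HB.instance Definition _ :=
  isOpenTopological.Build (zariski K N) openT openI open_bigcup.

End Zariski.

Section FreeAlgebra.
Variables (K : fieldType) (n : nat).

(* K<x_1, ..., x_n>, the algebra over K of the free monoid of words on 'I_n. *)
Definition free_alg : Type := malg (fmonom 'I_n) K.

HB.instance Definition _ := GRing.Lalgebra.on free_alg.

Let scalerAr (a : K) (x y : free_alg) : a *: (x * y) = x * (a *: y).
Proof.
apply/malgP => w; rewrite mcoeffZ mcoeffMl.
rewrite (mcoeffMlw w (finmap.fsubset_refl (msupp x)) (msuppZ_le a y)).
rewrite mulr_sumr; apply: eq_bigr => u _; rewrite mulr_sumr.
apply: eq_bigr => v _; rewrite mcoeffZ.
by rewrite mulrCA mulrnAr.
Qed.

HB.instance Definition _ := GRing.Lalgebra_isAlgebra.Build K free_alg scalerAr.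

Definition gen (i : 'I_n) : free_alg := mkmalgU (fmu i) 1.

Definition homogeneous (q : nat) : set free_alg :=
  [set f | forall w, mcoeff w f != 0 -> fdeg w = q].

End FreeAlgebra.

Section QuadraticAlgebra.
Variables (K : fieldType) (n d : nat).

(* The affine space K^(n^2 d) of coefficient vectors (c_{j,k,m}). *)
Definition coef_space : Type := zariski K (d * (n * n)).

HB.instance Definition _ := Topological.on coef_space.

Variable c : coef_space.

Definition coef (j : 'I_d) (k m : 'I_n) : K :=
  c 0 (mxvec_index j (mxvec_index k m)).

Definition quad_rel (j : 'I_d) : free_alg K n :=
  \sum_k \sum_m coef j k m *: (gen K k * gen K m).

Definition quad_ideal : {pred free_alg K n} :=
  fun f => `[< ideal_gen (range quad_rel) f >].

Let quad_idealP f : reflect (ideal_gen (range quad_rel) f) (f \in quad_ideal).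
Proof. exact: asboolP. Qed.

Let quad_idealMl a f : f \in quad_ideal -> a * f \in quad_ideal.
Proof.
have [_ _ Ml _] := two_sided_ideal_gen (range quad_rel).
by move=> /quad_idealP If; apply/quad_idealP; apply: Ml.
Qed.

Let quad_idealMr a f : f \in quad_ideal -> f * a \in quad_ideal.
Proof.
have [_ _ _ Mr] := two_sided_ideal_gen (range quad_rel).
by move=> /quad_idealP If; apply/quad_idealP; apply: Mr.
Qed.

Let quad_ideal1 : 1 \notin quad_ideal.
Proof.
pose J := [set f : free_alg K n | mcoeff (one : fmonom 'I_n) f = 0].
have eps1 (f g : free_alg K n) :
    mcoeff (one : fmonom 'I_n) (f * g) =
    mcoeff (one : fmonom 'I_n) f * mcoeff (one : fmonom 'I_n) g.
  exact: (mcoeff1g_is_multiplicative (fmonom 'I_n) K).1.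
apply/negP => /quad_idealP /(_ J) J1.
suff /J1 : two_sided_ideal J /\ range quad_rel `<=` J.
  by rewrite /J /= mcoeff1 eqxx => /eqP; rewrite oner_eq0.
split; first split; rewrite /J /=.
- by rewrite mcoeff0.
- by move=> f g f0 g0; rewrite mcoeffB f0 g0 subrr.
- by move=> a f f0; rewrite eps1 f0 mulr0.
- by move=> a f f0; rewrite eps1 f0 mul0r.
- move=> _ [j _ <-]; rewrite /J /= /quad_rel raddf_sum big1 // => k _.
  rewrite raddf_sum big1 // => m _ /=; rewrite mcoeffZ eps1 mcoeffU.
  have /negPf-> : fmu k != one by rewrite fmP fm1 fmuE.
  by rewrite mulr0n mul0r mulr0.
Qed.

Let quad_ideal_zmod_closed : zmod_closed quad_ideal.
Proof.
have [I0 IB _ _] := two_sided_ideal_gen (range quad_rel).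
split; first exact/quad_idealP.
by move=> f g /quad_idealP If /quad_idealP Ig; apply/quad_idealP; apply: IB.
Qed.

HB.instance Definition _ :=
  GRing.isZmodClosed.Build (free_alg K n) quad_ideal quad_ideal_zmod_closed.

Definition quad_alg : Type := Quotient.quot quad_ideal.

HB.instance Definition _ := ZmodQuotient.on quad_alg.

Definition quad_proj (f : free_alg K n) : quad_alg := \pi_quad_alg f.

Let projP f g : reflect (quad_proj f = quad_proj g) (f - g \in quad_ideal).
Proof. by rewrite Quotient.idealrBE; exact: eqP. Qed.

Let reprK (x : quad_alg) : quad_proj (repr x) = x.
Proof. exact: reprK. Qed.

Let projD f g : quad_proj (f + g) = quad_proj f + quad_proj g.
Proof. exact: pi_addr. Qed.

Let qone : quad_alg := quad_proj 1.
Let qmul (x y : quad_alg) : quad_alg := quad_proj (repr x * repr y).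
Let qscale (a : K) (x : quad_alg) : quad_alg := quad_proj (a *: repr x).

Let qmulE f g : qmul (quad_proj f) (quad_proj g) = quad_proj (f * g).
Proof.
apply/projP; set f' := repr _; set g' := repr _.
have -> : f' * g' - f * g = (f' - f) * g' + f * (g' - g).
  by rewrite mulrBl mulrBr addrA subrK.
apply: rpredD; first by apply/quad_idealMr/projP; rewrite reprK.
by apply/quad_idealMl/projP; rewrite reprK.
Qed.

Let qscaleE a f : qscale a (quad_proj f) = quad_proj (a *: f).
Proof.
apply/projP; rewrite -scalerBr -mulr_algl.
by apply/quad_idealMl/projP; rewrite reprK.
Qed.

Let qmulA : associative qmul.
Proof.
by move=> x y z; rewrite -[x]reprK -[y]reprK -[z]reprK !qmulE mulrA.
Qed.

Let qmul1l : left_id qone qmul.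
Proof. by move=> x; rewrite -[x]reprK qmulE mul1r. Qed.

Let qmul1r : right_id qone qmul.
Proof. by move=> x; rewrite -[x]reprK qmulE mulr1. Qed.

Let qmulDl : left_distributive qmul +%R.
Proof.
move=> x y z; rewrite -[x]reprK -[y]reprK -[z]reprK.
by rewrite -projD !qmulE mulrDl projD.
Qed.

Let qmulDr : right_distributive qmul +%R.
Proof.
move=> x y z; rewrite -[x]reprK -[y]reprK -[z]reprK.
by rewrite -projD !qmulE mulrDr projD.
Qed.

Let qone_neq0 : qone != 0.
Proof.
have -> : 0 = quad_proj 0 by apply: esym; exact: pi_zeror.
apply/eqP.
by move=> /projP; rewrite subr0 (negPf quad_ideal1).
Qed.

HB.instance Definition _ := GRing.Zmodule_isNzRing.Build quad_alg
  qmulA qmul1l qmul1r qmulDl qmulDr qone_neq0.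

Let qscaleA a b x : qscale a (qscale b x) = qscale (a * b) x.
Proof. by rewrite -[x]reprK !qscaleE scalerA. Qed.

Let qscale1 : left_id 1 qscale.
Proof. by move=> x; rewrite -[x]reprK qscaleE scale1r. Qed.

Let qscaleDr : right_distributive qscale +%R.
Proof.
move=> a x y; rewrite -[x]reprK -[y]reprK -projD !qscaleE.
by rewrite scalerDr projD.
Qed.

Let qscaleDl x : {morph qscale^~ x : a b / a + b}.
Proof. by move=> a b; rewrite -[x]reprK !qscaleE scalerDl projD. Qed.

HB.instance Definition _ := GRing.Zmodule_isLmodule.Build K quad_alg
  qscaleA qscale1 qscaleDr qscaleDl.

Let qscaleAl (a : K) (x y : quad_alg) : a *: (x * y) = (a *: x) * y.
Proof.
rewrite -[x]reprK -[y]reprK.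
by rewrite [LHS](congr1 (qscale a) (qmulE _ _)) qscaleE scalerAl -qmulE -qscaleE.
Qed.

HB.instance Definition _ :=
  GRing.Lmodule_isLalgebra.Build K quad_alg qscaleAl.

Let qscaleAr (a : K) (x y : quad_alg) : a *: (x * y) = x * (a *: y).
Proof.
rewrite -[x]reprK -[y]reprK.
by rewrite [LHS](congr1 (qscale a) (qmulE _ _)) qscaleE scalerAr -qmulE -qscaleE.
Qed.

HB.instance Definition _ :=
  GRing.Lalgebra_isAlgebra.Build K quad_alg qscaleAr.

Lemma quad_proj_is_linear : linear quad_proj.
Proof. by move=> a f g; rewrite projD -qscaleE. Qed.

HB.instance Definition _ :=
  GRing.isLinear.Build K (free_alg K n) quad_alg *:%R quad_proj
    quad_proj_is_linear.

Lemma quad_proj_is_monoid_morphism : monoid_morphism quad_proj.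
Proof. by split=> // f g; rewrite -qmulE. Qed.

HB.instance Definition _ :=
  GRing.isMonoidMorphism.Build (free_alg K n) quad_alg quad_proj
    quad_proj_is_monoid_morphism.

Lemma quad_proj_surj (x : quad_alg) : exists f, quad_proj f = x.
Proof. by exists (repr x); exact: reprK. Qed.

Lemma quad_proj_eq0 f : quad_proj f = 0 <-> ideal_gen (range quad_rel) f.
Proof.
rewrite -(raddf0 quad_proj).
split=> [/projP|If]; rewrite ?subr0; first by move/quad_idealP.
by apply/projP; rewrite subr0; apply/quad_idealP.
Qed.

Definition grade (q : nat) : set quad_alg := quad_proj @` homogeneous q.

(* [h q] is the coefficient of t^q. *)
Definition is_hilbert_series (h : nat -> nat) : Prop :=
  forall q, has_dim (grade q) (h q).

Definition finite_dimensional : Prop := exists m, has_dim [set: quad_alg] m.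

End QuadraticAlgebra.

(* A coefficient vector presents a quadratic algebra with n generators and d
   relations only when its d relations are linearly independent. *)
Definition generic_quad_alg (K : fieldType) (n d : nat)
    (P : coef_space K n d -> Prop) : Prop :=
  exists U : set (coef_space K n d), [/\ open U, dense U &
    U `<=` [set c | lin_indep (quad_rel c) /\ P c]].

Arguments generic_quad_alg K n d P : clear implicits.

(* Main.v *)
Require Import Defs.
From HB Require Import structures.
From mathcomp Require Import all_boot all_order all_algebra.
From mathcomp Require Import all_classical all_reals all_analysis.
From mathcomp Require Import lra.
From mathcomp.multinomials Require Import -(notations) mpoly.
From mathcomp.multinomials Require Import -(notations) monalg.

Set Implicit Arguments.
Unset Strict Implicit.
Unset Printing Implicit Defensive.

Import Order.TTheory GRing.Theory Num.Theory.

Local Open Scope ring_scope.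
Local Open Scope classical_set_scope.

(** Everything follows from one vanishing statement: for a generic choice of
    coefficients all words of length 6 lie in the ideal of relations, that is,
    R_6 = 0.  Then R_q = 0 for every q >= 6 and R is spanned by the finitely
    many words of length at most 5.

    _Where 5/16 comes from._  With 4 generators and 5 relations the
    Golod-Shafarevich series 1/(1 - 4t + 5t^2) starts as
    1 + 4t + 11t^2 + 24t^3 + 41t^4 + 44t^5 - 29t^6, and its first negative
    coefficient allows an algebra A with A_6 = 0.  The five relations
    [base_rels] present such an algebra over the field with two elements;
    [base_nilpotent] establishes this by Gaussian elimination one degree at a
    time, where the quotients never exceed dimension 44.  The relations of A
    are then blown up: each generator x_a is replaced by m generators x_(a,s)
    and each relation f by the m^2 relations obtained by decorating its two
    letters with indices s and t.  The resulting algebra is A_q tensored with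
    the words of length q in m letters, so it vanishes in degree 6 as well
    ([blowup_nilpotent]).  For n generators take m just above n/4 and discard
    the superfluous generators; this uses 5 m^2 relations, asymptotically
    5/16 n^2, hence at most d_n for large n ([eventually_blowup]).

    _From one algebra over F_2 to generic algebras over K._  The space R_6
    vanishes as soon as the products u f_j v, with u and v words of total
    length 4, span all words of length 6.  Their coefficients form the
    Macaulay matrix, whose entries are linear in the coefficients of the
    relations.  For the blown-up algebra the matrix has full rank over F_2, so
    that some integer matrix B satisfies det (B Macaulay) = 1 modulo 2
    ([odd_minor]).  This odd integer is nonzero in every field K of
    characteristic 0.  Hence, for this fixed B, the function
    c |-> det (B Macaulay(c)) is a polynomial in the coefficient vector c that
    does not vanish identically, and R_6 = 0 wherever it is nonzero
    ([word_in_ideal]).  A second determinant detects the linear independence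
    of the relations.  As K is infinite, the locus where neither determinant
    vanishes is a dense Zariski open set ([polynomial_fun_dense]).

    Over F_2 the argument runs in dual form: instead of showing that the
    products span, it shows that a functional on words killed by all of them
    is zero.  Functionals restrict well, both to words with a fixed
    right-hand end and to words with fixed block indices, which makes the
    elimination and the blow-up a matter of substitution. *)

(** * Four generators, five relations: elimination over F_2 *)

(** Vectors over F_2 are bit sequences, read as masks selecting the entries to
    be summed; a sequence that is too short is padded with zeros. *)
Fixpoint add_mask (s t : bitseq) : bitseq :=
  match s, t with
  | [::], _ => t
  | _, [::] => s
  | x :: s', y :: t' => (x (+) y) :: add_mask s' t'
  end.

Definition dot (r : bitseq) (x : seq 'F_2) : 'F_2 := \sum_(y <- mask r x) y.

Definition combine (p : bitseq) (T : seq bitseq) : bitseq :=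
  foldr add_mask [::] (mask p T).

(** Solves the homogeneous system [rows] in [n] unknowns over F_2.  The result
    [(m, T)] consists of the mask [m] of the free unknowns and of a table [T]
    expressing each unknown as a combination of the free ones.  An unknown is
    a pivot when some row contains it; the remainder [p] of that row then
    gives its value, once the later unknowns have been solved for. *)
Fixpoint eliminate (n : nat) (rows : seq bitseq) : bitseq * seq bitseq :=
  if n is n'.+1 then
    if [seq behead r | r <- rows & head false r] is p :: ps then
      let: (m, T) := eliminate n' ([seq behead r | r <- rows & ~~ head false r]
                               ++ [seq add_mask p r | r <- ps]) in
      (false :: m, combine p T :: T)
    else
      let: (m, T) := eliminate n' [seq behead r | r <- rows] in
      (true :: m, [:: true] :: [seq false :: t | t <- T])
  else ([::], [::]).

Lemma addrrF2 (x : 'F_2) : x + x = 0.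
Proof. by case: x => [[|[|//]] i]; apply/val_inj. Qed.

Lemma addr_eq0F2 (x y : 'F_2) : x + y = 0 -> x = y.
Proof. by move=> xy0; rewrite -[x]addr0 -(addrrF2 y) addrA xy0 add0r. Qed.

Lemma dot_cons b r y x : dot (b :: r) (y :: x) = y *+ b + dot r x.
Proof. by case: b; rewrite /dot /= ?big_cons ?add0r. Qed.

Lemma dot0l x : dot [::] x = 0. Proof. by rewrite /dot big_nil. Qed.
Lemma dot0r r : dot r [::] = 0. Proof. by rewrite /dot mask0 big_nil. Qed.

Lemma dot_add_mask s t x : dot (add_mask s t) x = dot s x + dot t x.
Proof.
elim: s t x => [|b s IHs] [|c t] [|y x] //=; rewrite ?dot0l ?dot0r ?addr0 ?add0r //.
rewrite !dot_cons IHs addrACA; congr (_ + _).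
by case: b; case: c => /=; rewrite ?addr0 ?add0r // addrrF2.
Qed.

Lemma dot_foldr_add_mask T x :
  dot (foldr add_mask [::] T) x = \sum_(t <- T) dot t x.
Proof.
by elim: T => [|t T IHT]; rewrite ?dot0l ?big_nil //= dot_add_mask IHT big_cons.
Qed.

Lemma dot_combine p T x : dot (combine p T) x = dot p [seq dot t x | t <- T].
Proof. by rewrite dot_foldr_add_mask /dot -map_mask big_map. Qed.

Lemma dot_behead r y x :
  dot r (y :: x) = y *+ head false r + dot (behead r) x.
Proof. by case: r => [|b r]; rewrite ?dot_cons // !dot0l mulr0n addr0. Qed.

Lemma eliminateP n rows x : size x = n -> {in rows, forall r, dot r x = 0} ->
  [seq dot t (mask (eliminate n rows).1 x) | t <- (eliminate n rows).2] = x.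
Proof.
elim: n rows x => [|n IHn] rows [|y x] //= [sz_x] rows0.
have {}IHn rows' := IHn rows' x sz_x.
case E: [seq _ | _ <- _ & _] => [|p ps].
  have /IHn : {in [seq behead r | r <- rows], forall r, dot r x = 0}.
    move=> _ /mapP[r rin ->].
    have r0 : head false r = false.
      apply/negbTE/negP => r1; have : r \in [seq r <- rows | head false r].
        by rewrite mem_filter r1.
      by case: [seq _ <- rows | _] E.
    by have := rows0 r rin; rewrite dot_behead r0 mulr0n add0r.
  case: (eliminate n _) => m T /= IH.
  rewrite dot_cons dot0l addr0 mulr1n -map_comp; congr (_ :: _).
  by rewrite -[RHS]IH; apply: eq_map => t /=; rewrite dot_cons add0r.
have rows_in r : r \in p :: ps -> dot r x = y.
  rewrite -E => /mapP[s]; rewrite mem_filter => /andP[s1 /rows0].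
  by rewrite dot_behead s1 mulr1n => /addr_eq0F2 -> ->.
set rows' := _ ++ _; have /IHn : {in rows', forall r, dot r x = 0}.
  move=> r; rewrite mem_cat => /orP[] /mapP[s].
    rewrite mem_filter => /andP[/negPf s0 /rows0].
    by rewrite dot_behead s0 mulr0n add0r => + ->.
  move=> sin ->; rewrite dot_add_mask !rows_in ?addrrF2 ?mem_head //.
  by rewrite in_cons sin orbT.
case: (eliminate n _) => m T /= IH; congr (_ :: _) => //.
by rewrite dot_combine IH rows_in ?mem_head.
Qed.

Lemma size_eliminate n rows : size (eliminate n rows).2 = n.
Proof.
elim: n rows => //= n IHn rows; case: [seq _ | _ <- _ & _] => [|p ps].
  case: (eliminate n _) (IHn [seq behead r | r <- rows]) => m T /= <-.
  by rewrite size_map.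
set rows' := _ ++ _.
by case: (eliminate n _) (IHn rows') => m T /= <-.
Qed.

(** The coordinates of [t] times the letter [k], when the columns are the
    products of the basis words with the four letters, listed word by word. *)
Definition spread (k : nat) (t : bitseq) : bitseq :=
  flatten [seq [seq b && (j == k) | j <- iota 0 4] | b <- t].

(** The component of degree [q] of an algebra with generators 0, 1, 2, 3 is
    described by a pair [(B, T)]: [B] lists words whose classes form a basis,
    and [T] gives, for each basis word of degree [q - 1] and each letter, the
    coordinates of their product.  Modulo the relations already used in lower
    degrees, the component of degree [q + 1] has the products of [B] with the
    letters as generators, and the products of the basis words of degree
    [q - 1] with the quadratic relations as its only relations. *)
Section Levels.
Variable rels : seq (seq (nat * nat)).

Definition level_step (S : seq (seq nat) * seq (seq bitseq)) :=
  let: (B, T) := S in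
  let cols := mkseq (fun i => rcons (nth [::] B (i %/ 4)%N) (i %% 4)%N) (size B * 4) in
  let rows := [seq foldr add_mask [::] [seq spread p.2 (nth [::] Tu p.1) | p <- f]
              | Tu <- T, f <- rels] in
  let: (m, T') := eliminate (size B * 4) rows in
  (mask m cols,
   mkseq (fun i => mkseq (fun k => nth [::] T' (i * 4 + k)%N) 4) (size B)).

Definition levels q := iter q level_step ([:: [::]], [::]).

Variable phi : seq nat -> 'F_2.
Hypothesis rel_in : {in rels, forall f, {in f, forall p, (p.1 < 4) && (p.2 < 4)}}%N.
Hypothesis phi_rel : forall u v f, f \in rels ->
  \sum_(p <- f) phi (u ++ [:: p.1, p.2 & v]) = 0.

Definition values (B : seq (seq nat)) v := [seq phi (w ++ v) | w <- B].

(** Soundness is tested against a functional [phi] that is killed by the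
    ideal.  Quantifying over the right-hand end [v] is what makes the
    induction on degrees possible: relations of degree [q] remain valid when
    multiplied by words on the right. *)
Definition level_ok q (S : seq (seq nat) * seq (seq bitseq)) :=
  [/\ {in S.2, forall Tu, exists u, forall k, (k < 4)%N -> forall v,
        phi (rcons u k ++ v) = dot (nth [::] Tu k) (values S.1 v)}
    & forall w, size w = q -> all (ltn^~ 4) w -> exists r, forall v,
        phi (w ++ v) = dot r (values S.1 v)].

Lemma dot_spread (k : nat) t B v : (k < 4)%N ->
  dot (spread k t)
    (mkseq (fun i => phi (rcons (nth [::] B (i %/ 4)%N) (i %% 4)%N ++ v)) (size B * 4)) =
  dot t (values B (k :: v)).
Proof.
move=> k4.
have -> : mkseq (fun i => phi (rcons (nth [::] B (i %/ 4)%N) (i %% 4)%N ++ v))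
   (size B * 4) = flatten [seq [seq phi (w ++ j :: v) | j <- iota 0 4] | w <- B].
  elim: B => //= w B IHB; rewrite -IHB mulSn /mkseq iotaD map_cat /=.
  rewrite !cat_rcons; do 4!congr (_ :: _).
  rewrite -[iota 4 _]/(iota (4 + 0) _) iotaDl -map_comp; apply: eq_map => i /=.
  by rewrite -[(4 + i)%N]/(1 * 4 + i)%N divnMDl // modnMDl.
elim: t B => [|b t IHt] [|w B]; rewrite ?dot0l ?dot0r //.
rewrite [RHS]dot_cons -/(values B (k :: v)) -IHt /spread /= !dot_cons !addrA.
congr (_ + _).
case: k k4 {IHt} => [|[|[|[|//]]]] _; case: b => /=;
  by rewrite ?mulr0n ?mulr1n ?addr0 ?add0r.
Qed.

(** Each functional [phi (_ ++ v)] assigns values to the columns that satisfy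
    all rows, so the table produced by the elimination holds for them,
    uniformly in [v]. *)
Lemma level_stepP q S : level_ok q S -> level_ok q.+1 (level_step S).
Proof.
case: S => B T [/= T_ok B_ok]; rewrite /level_step.
set cols := mkseq _ _; set rows := [seq _ | _ <- _, _ <- _].
pose x v := values cols v.
have xE v : x v =
  mkseq (fun i => phi (rcons (nth [::] B (i %/ 4)%N) (i %% 4)%N ++ v)) (size B * 4).
  by rewrite /x /values /cols -map_comp.
have rows0 v : {in rows, forall r, dot r (x v) = 0}.
  move=> _ /allpairsP[[Tu f] /= [Tu_in f_in ->]].
  have [u Tu_u] := T_ok _ Tu_in.
  rewrite dot_foldr_add_mask big_map -[RHS](phi_rel u v f_in).
  apply: eq_big_seq => p p_in; have /andP[p1 p2] := rel_in f_in p_in.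
  by rewrite xE dot_spread // -Tu_u // cat_rcons.
have sz_x v : size (x v) = (size B * 4)%N by rewrite xE size_mkseq.
have := size_eliminate (size B * 4) rows; have := fun v => eliminateP (sz_x v) (rows0 v).
case: (eliminate _ rows) => m T' /= elim_x sz_T'.
have xT i k v : (i < size B)%N -> (k < 4)%N ->
    phi (rcons (nth [::] B i) k ++ v) =
    dot (nth [::] T' (i * 4 + k)) (values (mask m cols) v).
  move=> iB k4; have ik : (i * 4 + k < size B * 4)%N.
    rewrite -addn1 -addnA (leq_trans _ (leq_mul iB (leqnn 4))) // mulSn addnC.
    by rewrite leq_add2r addn1.
  transitivity (nth 0 (x v) (i * 4 + k)).
    by rewrite xE nth_mkseq // divnMDl // modnMDl divn_small // addn0 modn_small.
  rewrite -[in LHS](elim_x v) (nth_map [::]) ?sz_T' //.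
  by rewrite /x /values map_mask.
have step_sum k s : (k < 4)%N -> {subset s <= B} -> exists r, forall v,
    \sum_(b <- s) phi (rcons b k ++ v) = dot r (values (mask m cols) v).
  move=> k4; elim: s => [|b s IHs] sB.
    by exists [::] => v; rewrite big_nil dot0l.
  have [|r rP] := IHs; first by move=> c cs; rewrite sB // in_cons cs orbT.
  have b_in : b \in B by rewrite sB // mem_head.
  exists (add_mask (nth [::] T' (index b B * 4 + k)) r) => v.
  by rewrite big_cons dot_add_mask rP -xT ?index_mem // nth_index.
split=> /=.
  move=> _ /mapP[i + ->]; rewrite mem_iota add0n => /= iB.
  by exists (nth [::] B i) => k k4 v; rewrite nth_mkseq // xT.
move=> w; case/lastP: w => // w k; rewrite size_rcons all_rcons.
move=> [/B_ok Bw] /andP[k4 /Bw[r wr]].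
have [|r' r'P] := step_sum k (mask r B) k4; first by move=> b; apply: mem_mask.
exists r' => v; rewrite -r'P cat_rcons wr /dot /values -map_mask big_map.
by apply: eq_bigr => b _; rewrite cat_rcons.
Qed.

Lemma levels_vanish q : (levels q).1 = [::] -> forall w,
  size w = q -> all (ltn^~ 4) w -> phi w = 0.
Proof.
have: level_ok q (levels q).
  elim: q => [|q IHq]; last by rewrite /levels iterS; apply: level_stepP.
  (* In degree 0 the empty word is the basis, and no product lands there. *)
  split=> // w /size0nil-> _; exists [:: true] => v.
  by rewrite dot_cons dot0l addr0.
case=> _ B_ok B0 w sz_w w4; have [r rP] := B_ok w sz_w w4.
by have := rP [::]; rewrite B0 cats0 dot0r.
Qed.

End Levels.

(** With a, b, c, d standing for 0, 1, 2, 3, the relations are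
    bc + aa + cc, db + dd + cc, da + bd + ab, bb + ca, cd + ba.  Modulo
    2 the algebra has the dimensions 1, 4, 11, 24, 41, 44, 0 of a generic
    algebra with four generators and five relations. *)
Definition base_rels : seq (seq (nat * nat)) :=
  [:: [:: (1, 2); (0, 0); (2, 2)];
      [:: (3, 1); (3, 3); (2, 2)];
      [:: (3, 0); (1, 3); (0, 1)];
      [:: (1, 1); (2, 0)];
      [:: (2, 3); (1, 0)]]%N.

Lemma base_nilpotent (phi : seq nat -> 'F_2) :
  (forall u v f, f \in base_rels ->
     \sum_(p <- f) phi (u ++ [:: p.1, p.2 & v]) = 0) ->
  forall w, size w = 6 -> all (ltn^~ 4) w -> phi w = 0.
Proof.
move=> phi_rel; apply: (levels_vanish _ phi_rel); last by vm_compute.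
have /allP ok : all (all (fun p => (p.1 < 4) && (p.2 < 4))%N) base_rels by [].
by move=> f /ok /allP.
Qed.

(** * Blowing up the generators *)

(** The letter [4 * s + a] stands for the copy of index [s] of the base letter
    [a], and the relation of index [r = (j * m + s) * m + t] for the base
    relation [j] with its first letters decorated by [s] and its second
    letters by [t].  For [r >= 5 * m^2] the relation is zero. *)
Definition blowup_coef (m r k l : nat) : nat :=
  let s := (r %/ m %% m)%N in let t := (r %% m)%N in
  count (fun p => (4 * s + p.1 == k) && (4 * t + p.2 == l))%N
    (nth [::] base_rels (r %/ (m * m))).

Lemma sum_pick (V : nmodType) (n K L : nat) (g : nat -> nat -> V) :
  (forall k l, ~~ ((k < n) && (l < n))%N -> g k l = 0) ->
  \sum_(k < n) \sum_(l < n) g k l *+ ((K == k :> nat) && (L == l :> nat)) = g K L.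
Proof.
move=> g0; have [KL|KL] := boolP ((K < n) && (L < n))%N.
  have /andP[Kn Ln] := KL.
  rewrite (bigD1 (Ordinal Kn)) //= (bigD1 (Ordinal Ln)) //= !eqxx mulr1n.
  rewrite big1 => [|l /eqP lL]; first rewrite big1 ?addr0 // => k kK.
    rewrite big1 // => l _; rewrite -[K == k]/(Ordinal Kn == k :> nat) eq_sym.
    by rewrite (inj_eq val_inj) (negPf kK).
  rewrite andbC; case: eqP => // E; case: lL; exact/val_inj.
rewrite g0 // big1 // => k _; rewrite big1 // => l _.
case: (K =P k) => [Kk|//]; case: (L =P l) => [Ll|//].
by rewrite Kk Ll !ltn_ord in KL.
Qed.

Lemma mulrn_count (V : nmodType) (T : Type) (a : pred T) (s : seq T) (x : V) :
  x *+ count a s = \sum_(p <- s) x *+ a p.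
Proof. by elim: s => [|p s IHs]; rewrite ?big_nil //= mulrnDr big_cons IHs. Qed.

(** Fixing the indices [w_i %/ 4] of the copies at each of the six positions
    turns [psi] into a functional [phi] on words in the four base letters,
    which is killed by the base relations.  Functionals vanish on letters
    beyond [n], which amounts to setting the superfluous generators to 0. *)
Lemma blowup_nilpotent (n m d : nat) (psi : seq nat -> 'F_2) :
  (n <= 4 * m)%N -> (5 * (m * m) <= d)%N ->
  (forall w, ~~ all (ltn^~ n) w -> psi w = 0) ->
  (forall u v r, (r < d)%N -> \sum_(k < n) \sum_(l < n)
     psi (u ++ [:: val k, val l & v]) *+ blowup_coef m r k l = 0) ->
  forall w, size w = 6 -> psi w = 0.
Proof.
move=> nm md psi0 psi_rel w sz_w; have [w_n|/psi0//] := boolP (all (ltn^~ n) w).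
pose S := [seq x %/ 4 | x <- w]%N.
pose lift (x : nat * nat) := (4 * x.1 + x.2)%N.
pose phi a := if size a == 6 then psi [seq lift x | x <- zip S a] else 0.
have S_m : all (ltn^~ m) S.
  rewrite all_map; apply: sub_all w_n => x /= xn.
  by rewrite ltn_divLR // mulnC (leq_trans xn).
have szS : size S = 6 by rewrite size_map.
have phi_rel u v f : f \in base_rels ->
    \sum_(p <- f) phi (u ++ [:: p.1, p.2 & v]) = 0.
  move=> f_in; rewrite /phi.
  have [sz6|sz6] := eqVneq (size u + (size v).+2)%N 6; last first.
    by rewrite big1 // => p _; rewrite size_cat /= (negPf sz6).
  under eq_bigr => p _ do rewrite size_cat /= sz6 eqxx.
  have sz_dr : size (drop (size u) S) = (size v).+2 by rewrite size_drop szS -sz6 addKn.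
  have := cat_take_drop (size u) S.
  have : size (take (size u) S) = size u.
    by rewrite size_take szS -sz6 addnS ltnS leq_addr.
  move: sz_dr; case: (drop _ S) => [//|s [//|t S2]] [szS2].
  move: (take _ S) => S1 szS1 defS.
  move: S_m; rewrite -defS all_cat /= => /and4P[_ sm tm _].
  under eq_bigr => p _ do rewrite zip_cat //= map_cat /=.
  pose j := index f base_rels; pose r := (j * (m * m) + (s * m + t))%N.
  have j5 : (j < 5)%N by rewrite -[5%N]/(size base_rels) index_mem.
  have m0 : (0 < m)%N by apply: leq_ltn_trans sm.
  have stm : (s * m + t < m * m)%N.
    by rewrite (@leq_trans (s.+1 * m)) ?leq_mul // mulSn addnC ltn_add2r.
  have rd : (r < d)%N.
    rewrite (leq_trans _ md) // (@leq_trans (j.+1 * (m * m))) ?leq_mul //.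
    by rewrite mulSn [leqRHS]addnC ltn_add2l.
  (* The relation f at the positions decorated by s and t is the one of
     index r; the double sum over letters collapses to its terms. *)
  rewrite -[RHS](psi_rel [seq lift x | x <- zip S1 u] [seq lift x | x <- zip S2 v] r rd).
  have r1 : (r %/ (m * m) = j)%N by rewrite divnMDl ?muln_gt0 ?m0 // divn_small ?addn0.
  have rE : r = ((j * m + s) * m + t)%N by rewrite /r addnA mulnA -mulnDl.
  have r2 : (r %/ m %% m = s)%N.
    by rewrite rE divnMDl // [(t %/ m)%N]divn_small // addn0 modnMDl modn_small.
  have r3 : (r %% m = t)%N by rewrite rE modnMDl modn_small.
  under [RHS]eq_bigr => k _.
    under eq_bigr => l _ do rewrite /blowup_coef r1 r2 r3 mulrn_count nth_index //.
    over.
  under [RHS]eq_bigr => k _ do rewrite exchange_big.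
  rewrite exchange_big /=; apply: eq_bigr => p _.
  rewrite (sum_pick (4 * s + p.1) (4 * t + p.2) (g := fun k l =>
    psi ([seq lift x | x <- zip S1 u] ++ [:: k, l & [seq lift x | x <- zip S2 v]]))) //.
  move=> k l kl; apply: psi0; rewrite all_cat /=; apply: contra kl.
  by case/and4P => _ -> ->.
have : phi [seq x %% 4 | x <- w]%N = 0.
  apply: (base_nilpotent phi_rel); first by rewrite size_map.
  by rewrite all_map; apply/allP => x _; rewrite /= ltn_mod.
rewrite /phi size_map sz_w eqxx zip_map -map_comp (_ : map _ w = w) //.
by rewrite -[RHS]map_id; apply: eq_map => x /=; rewrite /lift /= mulnC -divn_eq.
Qed.

(** * The Macaulay matrix and its odd minor *)

(** Injectivity on functionals is full column rank over F_2, hence a left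
    inverse [B] exists.  Reading its entries as 0 and 1 in the integers, the
    determinant of the product is 1 modulo 2, so it survives in
    characteristic 0. *)
Lemma odd_minor (I J : finType) (M : I -> J -> nat) :
  (forall phi : J -> 'F_2,
     (forall i, \sum_j (M i j)%:R * phi j = 0) -> forall j, phi j = 0) ->
  exists B : J -> I -> nat, forall (K : fieldType), [pchar K] =i pred0 ->
    \det (\matrix_(a < #|J|, b < #|J|)
      \sum_i (B (enum_val a) i)%:R * (M i (enum_val b))%:R : 'M[K]_#|J|) != 0.
Proof.
move=> Minj; pose N : 'M['F_2]_(#|I|, #|J|) :=
  \matrix_(a, b) (M (enum_val a) (enum_val b))%:R.
have /row_fullP[B BN] : row_full N.
  rewrite /row_full -mxrank_tr; apply: (inj_row_free (A := N^T)) => v vN.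
  apply/rowP => b; rewrite mxE -[b]enum_valK.
  apply: (Minj (fun j => v 0 (enum_rank j))) => i.
  have := congr1 (fun A : 'rV_#|I| => A 0 (enum_rank i)) vN.
  rewrite !mxE => vN0; rewrite -[RHS]vN0.
  rewrite (reindex (@enum_val J predT)) /=; last exact: onW_bij (enum_val_bij J).
  by apply: eq_bigr => j _; rewrite enum_valK !mxE enum_rankK mulrC.
exists (fun j i => val (B (enum_rank j) (enum_rank i))) => K K0.
pose D (R : pzRingType) : 'M[R]_#|J| := \matrix_(a, b)
  \sum_i (val (B (enum_rank (enum_val a)) (enum_rank i)))%:R * (M i (enum_val b))%:R.
have mapD (R : comPzRingType) : D R = map_mx intr (D int).
  apply/matrixP => a b; rewrite !mxE rmorph_sum /=; apply: eq_bigr => i _.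
  by rewrite rmorphM /= !rmorph_nat.
have D2 : D 'F_2 = 1%:M.
  rewrite -BN; apply/matrixP => a b; rewrite !mxE.
  rewrite [RHS](reindex (@enum_rank I)) /=; last exact: onW_bij (@enum_rank_bij I).
  by apply: eq_bigr => i _; rewrite enum_valK !mxE enum_rankK natr_Zp.
rewrite -/(D K) mapD det_map_mx.
have : \det (D 'F_2) != 0 by rewrite D2 det1 oner_eq0.
rewrite mapD det_map_mx; apply: contraNneq; move: (\det _) => z.
case: z => z; rewrite ?NegzE /= ?rmorphN /= => /eqP; rewrite ?oppr_eq0 -pmulrn.
  by have /pcharf0P -> := K0 => /eqP ->.
by have /pcharf0P -> := K0.
Qed.

(** [take p t] and [drop p t] are the two sides of the place where a relation
    is inserted, so that [(p, t)] ranges over the pairs of words of total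
    length [N]. *)
Definition place (N n : nat) (p : 'I_N.+1) (t : N.-tuple 'I_n) (k l : 'I_n) : seq 'I_n :=
  take p t ++ [:: k, l & drop p t].

Lemma size_place N n p t k l : size (@place N n p t k l) = N.+2.
Proof.
have pN : (p <= N)%N by rewrite -ltnS.
by rewrite size_cat /= size_drop size_takel size_tuple // !addnS subnKC.
Qed.

(** The coefficient of the word [w] in the product of a word, a relation and a
    word indexed by [i]. *)
Definition macaulay (A : nmodType) (N n d : nat) (c : 'I_d -> 'I_n -> 'I_n -> A)
    (i : 'I_N.+1 * 'I_d * N.-tuple 'I_n) (w : N.+2.-tuple 'I_n) : A :=
  \sum_k \sum_l c i.1.2 k l *+ (tval w == place i.1.1 i.2 k l).

Lemma macaulay_nat (A : pzRingType) N n d (c : 'I_d -> 'I_n -> 'I_n -> nat)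
    (i : 'I_N.+1 * 'I_d * N.-tuple 'I_n) w :
  (macaulay c i w)%:R = macaulay (fun j k l => (c j k l)%:R : A) i w.
Proof.
rewrite natr_sum; apply: eq_bigr => k _; rewrite natr_sum; apply: eq_bigr => l _.
by case: (_ == _).
Qed.

(** The matrix [B] comes from the field with two elements and does not depend
    on [K]. *)
Lemma blowup_minor n m d : (n <= 4 * m)%N -> (5 * (m * m) <= d)%N ->
  exists B : 6.-tuple 'I_n -> 'I_5 * 'I_d * 4.-tuple 'I_n -> nat,
  forall K : fieldType, [pchar K] =i pred0 ->
    \det (\matrix_(a < #|{: 6.-tuple 'I_n}|, b < #|{: 6.-tuple 'I_n}|)
      \sum_i (B (enum_val a) i)%:R *
        macaulay (fun j k l => (blowup_coef m j k l)%:R) i (enum_val b)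
      : 'M[K]_#|{: 6.-tuple 'I_n}|) != 0.
Proof.
move=> nm md.
have [|B detB] := @odd_minor _ _
    (@macaulay nat 4 n d (fun j k l => blowup_coef m j k l)); last first.
  exists B => K /detB; congr (\det _ != 0); apply/matrixP => a b; rewrite !mxE.
  by apply: eq_bigr => i _; rewrite macaulay_nat.
move=> phi phi_rel.
(* Extension by 0 to words of any length in any letters. *)
pose psi (s : seq nat) : 'F_2 :=
  \sum_(w : 6.-tuple 'I_n) phi w *+ (s == [seq val k | k <- w]).
have psiE (w : 6.-tuple 'I_n) : psi [seq val k | k <- w] = phi w.
  rewrite /psi (bigD1 w) //= eqxx mulr1n big1 ?addr0 // => v /eqP vw.
  case: eqP => // /inj_map E; case: vw; apply/val_inj/esym/E; exact: val_inj.
have psi0 s : size s != 6 \/ ~~ all (ltn^~ n) s -> psi s = 0.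
  move=> s0; rewrite /psi big1 // => w _; case: eqP => // sw.
  case: s0; rewrite sw; first by rewrite size_map size_tuple eqxx.
  by case/negP; rewrite all_map; apply/allP => k _ /=.
suff psi60 w : size w = 6 -> psi w = 0.
  by move=> w; rewrite -psiE psi60 ?size_map ?size_tuple.
move: w; apply: (blowup_nilpotent nm md) => [w w_n|u v r rd]; first by apply: psi0; right.
have [|uv4] := eqVneq (size u + size v)%N 4; last first.
  rewrite big1 // => k _; rewrite big1 // => l _; rewrite psi0 ?mul0rn //.
  by left; apply: contra uv4; rewrite size_cat /= !addnS !eqSS.
have [uv_n|uv_n] := boolP (all (ltn^~ n) (u ++ v)); last first.
  move=> _; rewrite big1 // => k _; rewrite big1 // => l _; rewrite psi0 ?mul0rn //.
  by right; apply: contra uv_n; rewrite !all_cat /= => /and4P[-> _ _ ->].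
move=> uv4; have p5 : (size u < 5)%N.
  by rewrite ltnS (leq_trans (leq_addr (size v) _)) ?uv4.
have [t uvE] : exists t : 4.-tuple 'I_n, [seq val k | k <- t] = u ++ v.
  have sz : size (pmap (insub : nat -> option 'I_n) (u ++ v)) == 4.
    rewrite size_pmap_sub.
    by move: uv_n; rewrite all_count => /eqP ->; rewrite size_cat uv4.
  exists (Tuple sz); rewrite /= (pmap_filter (@insubK _ _ _)); apply/all_filterP.
  by rewrite (eq_all (isSome_insub _)).
have uE : u = [seq val k | k <- take (size u) t] by rewrite map_take uvE take_size_cat.
have vE : v = [seq val k | k <- drop (size u) t] by rewrite map_drop uvE drop_size_cat.
rewrite -[RHS](phi_rel (Ordinal p5, Ordinal rd, t)) /=.
under [RHS]eq_bigr => w _ do rewrite macaulay_nat /macaulay mulr_suml.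
rewrite [RHS]exchange_big; apply: eq_bigr => k _ /=.
under [RHS]eq_bigr => w _ do rewrite mulr_suml.
rewrite [RHS]exchange_big; apply: eq_bigr => l _ /=.
pose w0 : 6.-tuple 'I_n := tcast (size_place (Ordinal p5) t k l) (in_tuple _).
have w0E : tval w0 = place (Ordinal p5) t k l by rewrite val_tcast.
rewrite (bigD1 w0) //= -w0E eqxx big1 => [|w]; last first.
  by rewrite -val_eqE => /negPf ->; rewrite mulr0n mul0r.
rewrite addr0 mulr1n -psiE w0E /place map_cat /= -uE -vE.
by rewrite mulr_natl.
Qed.

(** * Polynomial functions on affine space *)

Section PolynomialFunctions.
Variables (K : fieldType) (N : nat).

Definition polynomial_fun (f : zariski K N -> K) : Prop :=
  exists p : mpoly.mpoly N K, forall x, mpoly_at p x = f x.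

Lemma polynomial_fun_const a : polynomial_fun (fun=> a).
Proof. by exists (mpolyC N a) => x; rewrite /mpoly_at mevalC. Qed.

Lemma polynomial_fun_coord i : polynomial_fun (fun x => x 0 i).
Proof. by exists (mpolyX K (mnm1 i)) => x; rewrite /mpoly_at mevalXU. Qed.

Lemma polynomial_funM f g :
  polynomial_fun f -> polynomial_fun g -> polynomial_fun (fun x => f x * g x).
Proof.
by move=> [p pf] [q qg]; exists (p * q) => x; rewrite /mpoly_at mevalM -pf -qg.
Qed.

Lemma polynomial_fun_sum (I : finType) (f : I -> zariski K N -> K) :
  (forall i, polynomial_fun (f i)) -> polynomial_fun (fun x => \sum_i f i x).
Proof.
move=> /choice[p pf]; exists (\sum_i p i) => x.
by rewrite /mpoly_at raddf_sum; apply: eq_bigr => i _; rewrite -pf.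
Qed.

Lemma polynomial_fun_prod (I : finType) (f : I -> zariski K N -> K) :
  (forall i, polynomial_fun (f i)) -> polynomial_fun (fun x => \prod_i f i x).
Proof.
move=> /choice[p pf]; exists (\prod_i p i) => x.
by rewrite /mpoly_at rmorph_prod; apply: eq_bigr => i _; rewrite -pf.
Qed.

Lemma polynomial_fun_det m (A : zariski K N -> 'M[K]_m) :
  (forall i j, polynomial_fun (fun x => A x i j)) ->
  polynomial_fun (fun x => \det (A x)).
Proof.
move=> Apoly; apply: polynomial_fun_sum => s.
by apply: polynomial_funM; [exact: polynomial_fun_const|exact: polynomial_fun_prod].
Qed.

(** Restriction to the line through [x] and [y], which reduces density
    questions to polynomials in one variable. *)
Lemma polynomial_fun_line f (x y : zariski K N) : polynomial_fun f ->
  exists q : {poly K}, forall t, q.[t] = f (\row_i (x 0 i + t * (y 0 i - x 0 i))).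
Proof.
move=> [p pf].
exists (\sum_(m <- mpoly.msupp p) (mpoly.mcoeff m p)%:P *
  \prod_i ((x 0 i)%:P + 'X * (y 0 i - x 0 i)%:P) ^+ m i) => t.
rewrite -pf /mpoly_at mevalE horner_sum; apply: eq_bigr => m _.
rewrite hornerM hornerC horner_prod; congr (_ * _); apply: eq_bigr => i _.
by rewrite horner_exp !hornerE mxE.
Qed.

Lemma polynomial_fun_open f : polynomial_fun f -> open [set x | f x != 0].
Proof.
move=> [p pf]; exists [set p]; apply/seteqP; split=> x /=.
  by rewrite -pf; exists p.
by move=> [_ -> ]; rewrite pf.
Qed.

Lemma infinite_field_nonroot (q : {poly K}) : [pchar K] =i pred0 -> q != 0 ->
  exists t, q.[t] != 0.
Proof.
move=> K0 q0; apply: contrapT => noroot.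
have inj : injective (fun i : nat => i%:R : K).
  have /pcharf0P nat0 := K0; have {}nat0 i j : (i <= j)%N -> i%:R = j%:R :> K -> i = j.
    move=> ij /eqP; rewrite eq_sym -subr_eq0 -natrB // nat0 subn_eq0 => ji.
    by apply/eqP; rewrite eqn_leq ij.
  by move=> i j; case/orP: (leq_total i j) => [/nat0//|/nat0 + /esym E] => /(_ E).
have := max_poly_roots (rs := [seq i%:R | i <- iota 0 (size q)]) q0.
rewrite size_map size_iota ltnn map_inj_uniq ?iota_uniq // => /(_ _ isT) F.
suff : false by []; apply: F; apply/allP => _ /mapP[i _ ->]; apply/rootP.
by apply: contrapT => /eqP qi; apply: noroot; exists i%:R.
Qed.

(** A nonempty basic open set contains a point [y] where some polynomial [p]
    is nonzero.  On the line joining [x] to [y] neither [f] nor [p] vanishes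
    identically, so over an infinite field both are nonzero at a common
    point. *)
Lemma polynomial_fun_dense f : [pchar K] =i pred0 -> polynomial_fun f ->
  (exists x, f x != 0) -> dense [set x | f x != 0].
Proof.
move=> K0 fpoly [x fx] O [y Oy] [S OE]; move: Oy; rewrite OE => -[p Sp py].
have ppoly : polynomial_fun (mpoly_at p) by exists p.
have [q qE] := polynomial_fun_line x y fpoly.
have [r rE] := polynomial_fun_line x y ppoly.
have q0 : q != 0.
  apply: contraNneq fx => q0; have := qE 0; rewrite q0 horner0 => {1}->.
  by apply/eqP; congr f; apply/rowP => i; rewrite mxE mul0r addr0.
have r0 : r != 0.
  apply: contraNneq py => r0; have := rE 1; rewrite r0 horner0 => {1}->.
  by apply/eqP; congr mpoly_at; apply/rowP => i; rewrite mxE mul1r addrC subrK.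
have [t] := infinite_field_nonroot K0 (mulf_neq0 q0 r0).
rewrite hornerM mulf_eq0 negb_or qE rE => /andP[ft pt].
by exists (\row_i (x 0 i + t * (y 0 i - x 0 i))); split=> //=; exists p.
Qed.

End PolynomialFunctions.

(** * Words in the free algebra and the ideal of relations *)

Section Words.
Variables (K : fieldType) (n : nat).

Definition word (s : seq 'I_n) : free_alg K n := \prod_(i <- s) gen K i.

Lemma wordE s : word s = mkmalgU (FMonom s) 1.
Proof.
elim: s => [|i s IHs].
  rewrite /word big_nil; apply/malgP => w; rewrite mcoeff1 mcoeffU eq_sym; congr (_ == _)%:R.
  by apply: val_inj; exact: fm1.
rewrite /word big_cons -/(word s) IHs /gen malgM_def fgmulUU mulr1.
congr (mkmalgU _ _); apply/eqP; rewrite fmP fmM fmuE; exact: eqxx.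
Qed.

Lemma word_cat s t : word (s ++ t) = word s * word t.
Proof. by rewrite /word big_cat. Qed.

Lemma free_algE (f : free_alg K n) :
  f = \sum_(w <- finmap.enum_fset (msupp f)) mcoeff w f *: word w.
Proof.
rewrite [LHS]monalgE; apply: eq_bigr => w _; rewrite wordE.
apply/malgP => v; rewrite mcoeffZ !mcoeffU.
by case: w => w; rewrite mulr_natr.
Qed.

Lemma word_homogeneous (s : seq 'I_n) : homogeneous (size s) (word s).
Proof.
by move=> w; rewrite wordE mcoeffU; case: (_ =P w) => [<-|_]; rewrite ?fdegE //= eqxx.
Qed.

Lemma homogeneous_lin q (a : q.-tuple 'I_n -> K) :
  homogeneous q (\sum_s a s *: word s).
Proof.
move=> w; apply: contraNeq => qw; rewrite raddf_sum big1 // => s _ /=.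
apply/eqP; apply: contraNT qw; rewrite mcoeffZ mulf_eq0 negb_or.
by case/andP=> _ /word_homogeneous ->; rewrite size_tuple.
Qed.

Lemma homogeneousE q (f : free_alg K n) : homogeneous q f ->
  exists a : q.-tuple 'I_n -> K, f = \sum_s a s *: word s.
Proof.
move=> fq; exists (fun s => mcoeff (FMonom s) f).
apply/malgP => w; rewrite raddf_sum /=.
have termE (s : q.-tuple 'I_n) : mcoeff w (mcoeff (FMonom s) f *: word s) =
    mcoeff w f *+ (tval s == w).
  rewrite mcoeffZ wordE mcoeffU -val_eqE /=; case: eqP => [sw|]; last by rewrite mulr0.
  by rewrite mulr1; congr mcoeff; apply/val_inj.
under eq_bigr => s _ do rewrite termE.
have [wq|wq] := eqVneq (fdeg w) q; last first.
  have -> : mcoeff w f = 0 by apply/eqP; apply: contraNT wq => /fq ->.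
  by rewrite big1 // => s _; rewrite mul0rn.
pose s : q.-tuple 'I_n := tcast wq (in_tuple _).
have sw : tval s = w by rewrite val_tcast.
rewrite (bigD1 s) //= sw eqxx big1 ?addr0 // => t.
by rewrite -val_eqE /= sw => /negPf ->.
Qed.

End Words.

Section Quadratic.
Variables (K : fieldType) (n d : nat) (c : coef_space K n d).

Lemma quad_rel_word j : quad_rel c j =
  \sum_k \sum_m coef c j k m *: word K [:: k; m].
Proof.
apply: eq_bigr => k _; apply: eq_bigr => m _.
by rewrite /word !big_cons big_nil mulr1.
Qed.

(** The relations are independent as soon as their coefficients at some [d]
    chosen monomials [e j] form an invertible matrix. *)
Lemma quad_rel_indep (e : 'I_d -> 'I_n * 'I_n) :
  \det (\matrix_(j, j') coef c j (e j').1 (e j').2) != 0 -> lin_indep (quad_rel c).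
Proof.
move=> det0 a a0 j; pose v := \row_j a j.
suff v0 : v = 0 by have := congr1 (fun A : 'rV_d => A 0 j) v0; rewrite !mxE.
move: det0; rewrite -unitfE -/(_ \in unitmx) => Mu.
rewrite -[v](mulmxK Mu) (_ : v *m _ = 0) ?mul0mx //; apply/rowP => i.
rewrite !mxE; have := congr1 (mcoeff (FMonom [:: (e i).1; (e i).2])) a0.
rewrite mcoeff0 raddf_sum => a0'; rewrite -[RHS]a0'.
apply: eq_bigr => j' _; rewrite !mxE /=.
rewrite mcoeffZ quad_rel_word; congr (_ * _).
rewrite raddf_sum (bigD1 (e i).1) //= raddf_sum (bigD1 (e i).2) //=.
rewrite mcoeffZ wordE mcoeffU eqxx mulr1 !big1 ?addr0 //.
  move=> k k0; rewrite raddf_sum big1 // => m _.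
  rewrite /= mcoeffZ wordE mcoeffU -val_eqE /= eqseq_cons (negPf k0) mulr0n mulr0 //.
move=> m m0; rewrite mcoeffZ wordE mcoeffU -val_eqE /= !eqseq_cons (negPf m0).
by rewrite andbF mulr0n mulr0.
Qed.

Local Notation I := (ideal_gen (range (quad_rel c))).

Lemma ideal_sum (T : Type) (r : seq T) (F : T -> free_alg K n) :
  (forall i, I (F i)) -> I (\sum_(i <- r) F i).
Proof.
move=> IF; elim/big_rec: _ => [|i f _ If].
  by have [] := two_sided_ideal_gen (range (quad_rel c)).
have [I0 IB _ _] := two_sided_ideal_gen (range (quad_rel c)).
by rewrite -[f]opprK; apply: (IB) => //; rewrite -sub0r; apply: IB.
Qed.

(** Each row of the Macaulay matrix represents an element of the ideal. *)
Lemma macaulay_ideal N (i : 'I_N.+1 * 'I_d * N.-tuple 'I_n) :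
  \sum_(w : N.+2.-tuple 'I_n) macaulay (coef c) i w *: word K w =
  word K (take i.1.1 i.2) * quad_rel c i.1.2 * word K (drop i.1.1 i.2).
Proof.
rewrite quad_rel_word mulr_sumr mulr_suml.
under eq_bigr => w _ do rewrite scaler_suml.
rewrite exchange_big; apply: eq_bigr => k _ /=.
rewrite mulr_sumr mulr_suml.
under eq_bigr => w _ do rewrite scaler_suml.
rewrite exchange_big; apply: eq_bigr => l _ /=.
pose w0 := tcast (size_place i.1.1 i.2 k l) (in_tuple _).
have w0E : tval w0 = place i.1.1 i.2 k l by rewrite val_tcast.
rewrite (bigD1 w0) //= -w0E eqxx mulr1n big1 ?addr0 => [|w]; last first.
  by rewrite -val_eqE => /negPf ->; rewrite mulr0n scale0r.
rewrite w0E /place -[_ :: _]/([:: k; l] ++ _) !word_cat mulrA.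
by rewrite -scalerAr -scalerAl.
Qed.

(** If the combinations [B] of the rows form an invertible matrix, the rows
    span all words of length [N + 2]. *)
Lemma word_in_ideal N (B : N.+2.-tuple 'I_n -> 'I_N.+1 * 'I_d * N.-tuple 'I_n -> K) :
  \det (\matrix_(a < #|{: N.+2.-tuple 'I_n}|, b < #|{: N.+2.-tuple 'I_n}|)
    \sum_i B (enum_val a) i * macaulay (coef c) i (enum_val b)) != 0 ->
  forall w : N.+2.-tuple 'I_n, I (word K w).
Proof.
rewrite -unitfE -/(_ \in unitmx); set M := \matrix_(a, b) _ => Mu w.
have -> : word K w = \sum_a (invmx M) (enum_rank w) a *:
    \sum_i B (enum_val a) i *: \sum_v macaulay (coef c) i v *: word K v.
  transitivity (\sum_b (invmx M *m M) (enum_rank w) b *: word K (enum_val b)).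
    rewrite mulVmx // (bigD1 (enum_rank w)) //= mxE eqxx scale1r enum_rankK.
    by rewrite big1 ?addr0 // => b /negPf bw; rewrite mxE eq_sym bw scale0r.
  under eq_bigr => b _ do rewrite mxE scaler_suml.
  rewrite exchange_big; apply: eq_bigr => a _ /=.
  under eq_bigr => b _ do rewrite -scalerA.
  rewrite -scaler_sumr; congr (_ *: _).
  have Mab b : M a b *: word K (enum_val b) = \sum_i
      (B (enum_val a) i * macaulay (coef c) i (enum_val b)) *: word K (enum_val b).
    by rewrite mxE scaler_suml.
  rewrite (eq_bigr _ (fun b _ => Mab b)).
  rewrite exchange_big; apply: eq_bigr => i _ /=; rewrite scaler_sumr.
  rewrite [RHS](reindex (@enum_val _ predT)) /=; last exact: onW_bij (enum_val_bij _).
  by apply: eq_bigr => b _; rewrite scalerA.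
have [I0 _ IMl IMr] := two_sided_ideal_gen (range (quad_rel c)).
apply: ideal_sum => a; rewrite -mulr_algl; apply: (IMl).
apply: ideal_sum => i; rewrite -mulr_algl; apply: (IMl).
rewrite macaulay_ideal; apply: IMr; apply: IMl.
by move=> J [_ JS]; apply: JS; exists i.1.2.
Qed.

End Quadratic.

(** * Dimensions and Hilbert series *)

Section SpanDimension.
Variables (K : fieldType) (V : lmodType K).

(** A spanning family that is not independent stays spanning when a vector with
    a nonzero coefficient in a linear relation is dropped. *)
Lemma has_dim_lin_span m (b : 'I_m -> V) : exists k, has_dim (lin_span b) k.
Proof.
elim: m b => [|m IHm] b; first by exists 0%N, b => // a _ [].
have [indep|] := pselect (lin_indep b); first by exists m.+1, b.
move=> /existsNP[a /not_implyP[ab0 /existsNP[i ai0]]].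
have [k bk] := IHm (fun j => b (lift i j)).
exists k; suff -> : lin_span b = lin_span (fun j => b (lift i j)) by [].
apply/seteqP; split=> _ [e ->]; last first.
  exists (fun j => if unlift i j is Some j' then e j' else 0).
  rewrite [RHS](bigD1_ord i) //= unlift_none scale0r add0r.
  by apply: eq_bigr => j _; rewrite liftK.
exists (fun j => e (lift i j) - e i / a i * a (lift i j)).
under [RHS]eq_bigr => j _ do rewrite scalerBl -scalerA.
rewrite [LHS](bigD1_ord i) //= sumrB -scaler_sumr addrC; congr (_ + _).
move: ab0; rewrite (bigD1_ord i) //= => /eqP; rewrite addrC addr_eq0 => /eqP ->.
by rewrite scalerN opprK scalerA divfK //; apply/eqP.
Qed.

Lemma has_dim_span (I : finType) (b : I -> V) :
  exists k, has_dim [set v | exists a : I -> K, v = \sum_i a i *: b i] k.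
Proof.
have [k bk] := has_dim_lin_span (fun i : 'I_#|I| => b (enum_val i)).
exists k; set W := mkset _.
suff -> : W = lin_span (fun i : 'I_#|I| => b (enum_val i)) by [].
apply/seteqP; split=> _ [a ->].
  exists (fun i => a (enum_val i)).
  by rewrite (reindex (@enum_val I predT)) //; exact: onW_bij (enum_val_bij I).
exists (fun i => a (enum_rank i)).
rewrite [RHS](reindex (@enum_val I predT)) /=; last exact: onW_bij (enum_val_bij I).
by apply: eq_bigr => i _; rewrite enum_valK.
Qed.

Lemma has_dim0 : has_dim [set 0 : V] 0.
Proof.
exists (fun=> 0) => [a _ []//|]; apply/seteqP; split=> [_ ->|_ [a ->]].
  by exists (fun=> 0); rewrite big_ord0.
by rewrite big_ord0.
Qed.

End SpanDimension.

Section Hilbert.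
Variables (K : fieldType) (n d : nat) (c : coef_space K n d).

Lemma gradeE (q : nat) : @grade K n d c q =
  [set v | exists a : q.-tuple 'I_n -> K, v = \sum_s a s *: quad_proj c (word K s)].
Proof.
have sumE (a : q.-tuple 'I_n -> K) : quad_proj c (\sum_s a s *: word K s) =
    \sum_s a s *: quad_proj c (word K s).
  by rewrite linear_sum; apply: eq_bigr => s _; rewrite linearZ.
apply/seteqP; split=> [_ [f /homogeneousE[a ->] <-]|_ [a ->]]; first by exists a.
by exists (\sum_s a s *: word K s) => //; apply: homogeneous_lin.
Qed.

Variable N : nat.
Hypothesis word_ideal : forall w : N.-tuple 'I_n,
  ideal_gen (range (quad_rel c)) (word K w).

Lemma quad_proj_word0 (s : seq 'I_n) : (N <= size s)%N ->
  quad_proj c (word K s) = 0.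
Proof.
move=> sN; rewrite -(cat_take_drop N s) word_cat rmorphM /=.
have szN : size (take N s) == N by rewrite size_takel.
have -> : quad_proj c (word K (take N s)) = 0.
  by apply/quad_proj_eq0; exact: (word_ideal (Tuple szN)).
by rewrite mul0r.
Qed.

Lemma nilpotent_grade q : (N <= q)%N -> @grade K n d c q = [set 0].
Proof.
move=> Nq; have proj0 (s : q.-tuple 'I_n) : quad_proj c (word K s) = 0.
  by rewrite quad_proj_word0 ?size_tuple.
rewrite gradeE; apply/seteqP; split=> [_ [a ->]|_ ->] /=.
  by rewrite big1 // => s _; rewrite proj0 scaler0.
by exists (fun=> 0); rewrite big1 // => s _; rewrite scale0r.
Qed.

Lemma nilpotent_hilbert :
  exists2 H : {poly nat}, is_hilbert_series c (fun q => H`_q) & (size H <= N)%N.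
Proof.
have /choice[h hP] q : exists k, has_dim (@grade K n d c q) k.
  by rewrite gradeE; apply: has_dim_span.
exists (\poly_(q < N) h q); last exact: size_poly.
move=> q; rewrite coef_poly; case: ltnP => // Nq.
by rewrite nilpotent_grade //; apply: has_dim0.
Qed.

Lemma nilpotent_finite_dimensional : finite_dimensional c.
Proof.
have [k kP] := has_dim_span (fun s : N.-bseq 'I_n => quad_proj c (word K s)).
exists k; suff <- : [set v | exists a : N.-bseq 'I_n -> K,
  v = \sum_s a s *: quad_proj c (word K s)] = [set: quad_alg c] by [].
apply/seteqP; split=> // x _; have [f <-] := quad_proj_surj x.
rewrite [f]free_algE linear_sum; elim/big_rec: _ => [|w v _ [a ->]].
  by exists (fun=> 0); rewrite big1 // => s _; rewrite scale0r.
rewrite linearZ /=; have [wN|/ltnW wN] := leqP (size w) N; last first.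
  by exists a; rewrite quad_proj_word0 // scaler0 add0r.
exists (fun s => a s + mcoeff w f *+ (s == Bseq wN)).
under [RHS]eq_bigr => s _ do rewrite scalerDl.
rewrite big_split addrC /=; congr (_ + _).
rewrite (bigD1 (Bseq wN)) //= eqxx mulr1n big1 ?addr0 // => s /negPf ->.
by rewrite mulr0n scale0r.
Qed.

End Hilbert.

(** Since [(n %/ 4).+1 <= (n + 4) / 4], the left-hand side is at most
    5/16 (n + 4)^2 = 5/16 n^2 + O(n), which a positive gap e in front of
    n^2 absorbs. *)
Lemma eventually_blowup (R : realType) (d : nat -> nat) :
  ((5 / 16)%:E < limn_einf (fun n => ((d n)%:R / (n%:R ^+ 2) : R)%:E))%E ->
  \forall n \near \oo, (5 * ((n %/ 4).+1 * (n %/ 4).+1) <= d n)%N.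
Proof.
rewrite limn_einf_lim; set u := fun n => _.
rewrite (cvg_lim _ (@cvg_einfs_sup _ u)) // => /ereal_sup_gt[_ [N _ <-]].
rewrite /einfs /=; case infE: (ereal_inf _) => [r| |] //.
  rewrite lte_fin -subr_gt0 => e_gt0; near=> n.
  have : (r%:E <= u n)%E.
    by rewrite -infE; apply: ereal_inf_lbound; exists n => //=; near: n; exists N.
  have n_ge10 : (10 <= n)%N by near: n; exists 10%N.
  have n_gt0 : 0 < n%:R :> R by rewrite ltr0n (leq_trans _ n_ge10).
  rewrite lee_fin ler_pdivlMr ?exprn_gt0 // => rn.
  rewrite -(ler_nat R) (le_trans _ rn) // !natrM.
  set e := r - 5 / 16 in e_gt0; have -> : r = e + 5 / 16 by rewrite subrK.
  (* 5/16 (8 n + 16) <= 3 n for n >= 10, so e n >= 3 is enough. *)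
  have en : 3 <= e * n%:R.
    rewrite -ler_pdivrMl //; near: n; exact: nbhs_infty_ger.
  have n4 : ((n %/ 4).+1)%:R <= (n%:R + 4) / 4 :> R.
    rewrite ler_pdivlMr // -natrM -natrD ler_nat mulSn addnC leq_add2r.
    exact: leq_trunc_div.
  have n10 : 10 <= n%:R :> R by rewrite ler_nat.
  have m0 : 0 <= ((n %/ 4).+1)%:R :> R by [].
  have m2 : ((n %/ 4).+1)%:R * ((n %/ 4).+1)%:R <= (n%:R + 4) / 4 * ((n%:R + 4) / 4) :> R.
    by apply: ler_pM.
  have : 3 * n%:R <= e * n%:R * n%:R by rewrite ler_pM2r.
  by nra.
move=> _; have : (ereal_inf (sdrop u N) <= u N)%E.
  by apply: ereal_inf_lbound; exists N => /=.
by rewrite infE leye_eq.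
Unshelve. all: by end_near. Qed.

Lemma exists_coef (K : fieldType) n d (g : 'I_d -> 'I_n -> 'I_n -> K) :
  exists c : coef_space K n d, forall j k l, coef c j k l = g j k l.
Proof.
exists (mxvec (\matrix_j mxvec (\matrix_(k, l) g j k l))) => j k l.
by rewrite /coef mxvecE mxE mxvecE mxE.
Qed.

(** The point [c1] where the first determinant is nonzero is the blown-up
    algebra; the point [c2] where the second one is nonzero has as relations
    [d] distinct monomials.  These may be different points: two nonempty open
    sets of the irreducible affine space meet. *)
Lemma generic_nilpotent (K : fieldType) n d m : [pchar K] =i pred0 ->
  (n <= 4 * m)%N -> (5 * (m * m) <= d)%N -> (d <= n * n)%N ->
  generic_quad_alg K n d
    (fun c => forall w : 6.-tuple 'I_n, ideal_gen (range (quad_rel c)) (word K w)).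
Proof.
move=> charK0 nm md dn.
have [B detB] := blowup_minor nm md.
pose f (c : coef_space K n d) :=
  \det (\matrix_(a < #|{: 6.-tuple 'I_n}|, b < #|{: 6.-tuple 'I_n}|)
      \sum_i (B (enum_val a) i)%:R * macaulay (coef c) i (enum_val b)).
have card_pairs : (d <= #|{: 'I_n * 'I_n}|)%N by rewrite card_prod card_ord.
pose e (j : 'I_d) : 'I_n * 'I_n := enum_val (widen_ord card_pairs j).
have e_inj : injective e by move=> i j /enum_val_inj /(congr1 val) /= ij; exact/val_inj.
pose g (c : coef_space K n d) := \det (\matrix_(j, j') coef c j (e j').1 (e j').2).
have coef_poly j k l : polynomial_fun (fun c : coef_space K n d => coef c j k l).
  exact: polynomial_fun_coord.
have f_poly : polynomial_fun f.
  apply: polynomial_fun_det => a b.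
  under [X in polynomial_fun X]eq_fun do rewrite mxE.
  apply: polynomial_fun_sum => i; apply: polynomial_funM.
    exact: polynomial_fun_const.
  apply: polynomial_fun_sum => k; apply: polynomial_fun_sum => l.
  case: (_ == _); first exact: coef_poly.
  exact: polynomial_fun_const.
have g_poly : polynomial_fun g.
  apply: polynomial_fun_det => a b.
  by under [X in polynomial_fun X]eq_fun do rewrite mxE.
have [c1 c1E] := exists_coef (fun (j : 'I_d) (k l : 'I_n) => (blowup_coef m j k l)%:R : K).
have f_c1 : f c1 != 0.
  rewrite /f (_ : coef c1 = fun j k l => (blowup_coef m j k l)%:R); first exact: detB.
  by apply/funext => j; apply/funext => k; apply/funext => l.
have [c2 c2E] := exists_coef (fun j k l => ((k, l) == e j)%:R : K).
have g_c2 : g c2 != 0.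
  rewrite /g (_ : \matrix_(j, j') _ = 1%:M) ?det1 ?oner_neq0 //.
  apply/matrixP => j j'; rewrite !mxE c2E -surjective_pairing.
  by rewrite (inj_eq e_inj) eq_sym.
have fg_poly := polynomial_funM f_poly g_poly.
exists [set c | f c * g c != 0]; split.
- exact: polynomial_fun_open.
- apply: polynomial_fun_dense => //.
  have [|c [/= gc fc]] := polynomial_fun_dense charK0 f_poly (ex_intro _ c1 f_c1) _
    (polynomial_fun_open g_poly); first by exists c2.
  by exists c; rewrite mulf_neq0.
- move=> c /=; rewrite mulf_eq0 negb_or => /andP[fc gc]; split.
    exact: quad_rel_indep gc.
  by move=> w; apply: (word_in_ideal (B := fun w i => (B w i)%:R)); exact: fc.
Qed.

Theorem corollary1p8 (R : realType) (K : fieldType) (charK0 : [pchar K] =i pred0)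
    (d : nat -> nat) (d_bounds : forall n, (0 < n)%N -> (0 < d n <= n ^ 2)%N)
    (d_liminf : ((5 / 16)%:E <
       limn_einf (fun n => ((d n)%:R / (n%:R ^+ 2) : R)%:E))%E) :
  \forall n \near \oo, generic_quad_alg K n (d n) (fun c =>
    (exists2 H : {poly nat}, is_hilbert_series c (fun q => H`_q) &
      (size H <= 6)%N) /\
    finite_dimensional c).
Proof.
near=> n; have n_gt0 : (0 < n)%N by near: n; exists 1%N.
have dn : (d n <= n * n)%N by have /andP[_] := d_bounds n n_gt0; rewrite expnS expn1.
have dm : (5 * ((n %/ 4).+1 * (n %/ 4).+1) <= d n)%N.
  by near: n; apply: eventually_blowup d_liminf.
have nm : (n <= 4 * (n %/ 4).+1)%N by rewrite mulnC ltnW // ltn_ceil.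
have [U [oU dU PU]] := generic_nilpotent charK0 nm dm dn.
exists U; split=> // c /PU[indep nilp]; split=> //; split.
  exact: nilpotent_hilbert nilp.
exact: nilpotent_finite_dimensional nilp.
Unshelve. all: by end_near. Qed.
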